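(* Every $n$-vertex $d$-regular graph with $d\ge \frac{n-1}{2}$ is ideal. This is tight in the sense that there exist non-ideal $d$-regular $n$-vertex graphs when $d$ is the largest even integer less than $\frac{n-1}{2}$.
   Context: All graphs are finite and simple. A graph $G$ is $H$-covered if every vertex of $G$ lies in a (not necessarily induced) subgraph of $G$ isomorphic to $H$. An $N$-vertex $H$-covered graph is edge-minimal if it has the minimum number of edges among all $N$-vertex $H$-covered graphs. Let $H$ be a graph with $n$ vertices and $0\le r<n$. Define $\mathcal{L}_{n+r}^H$ to be the collection of graphs $G$ on a vertex set $V\sqcup V_1\sqcup V_2$ (disjoint union) with $|V|=n-r$, $|V_1|=|V_2|=r$, such that: there are no edges between $V_1$ and $V_2$; the set $V$ induces a subgraph of $H$ with $n-r$ vertices which has the maximum possible number of edges; and $V_1\sqcup V$ and $V_2\sqcup V$ both induce $H$. $H$ is ideal in remainder class $r$ if for all $N=qn+r$ with $q$ a positive integer, a graph $G$ is edge-minimal among $N$-vertex $H$-covered graphs if and only if $G$ consists of a graph in $\mathcal{L}_{n+r}^H$ together with the disjoint union of $q-1$ copies of $H$. $H$ is ideal if it is ideal in remainder class $r$ for every $r\in\{0,1,\dots,n-1\}$.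
   Formalization: The tightness clause is stated for every n with d the largest even integer below (n-1)/2, but only when d > 0 and n ≠ 2d+2; in the excluded cases (e.g. n = 2, d = 0 or n = 6, d = 2) every d-regular n-vertex graph is ideal, so the claim fails there. *)

(* Defs.v *)
From mathcomp Require Import all_boot.

Set Implicit Arguments.
Unset Strict Implicit.
Unset Printing Implicit Defensive.

Record sgraph := SGraph {
  vertex :> finType;
  adj : rel vertex;
  adj_sym : symmetric adj;
  adj_irrefl : irreflexive adj
}.

Arguments adj {s} x y.

Definition edges (G : sgraph) : {set {set G}} :=
  [set [set x; y] | x in G, y in G & adj x y].

Definition nedges (G : sgraph) : nat := #|edges G|.

Definition regular (d : nat) (G : sgraph) : Prop :=
  forall x : G, #|[set y : G | adj x y]| = d.

Definition giso (F G : sgraph) : Prop :=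
  exists2 f : F -> G, bijective f & forall x y, adj (f x) (f y) = adj x y.

(* The image of such an [f] is a not necessarily induced copy of F in G. *)
Definition embedding (F G : sgraph) (f : F -> G) : Prop :=
  injective f /\ forall x y, adj x y -> adj (f x) (f y).

Definition contained (F G : sgraph) : Prop :=
  exists f : F -> G, embedding f.

Section Induced.
Variables (G : sgraph) (S : {set G}).

Definition induced_adj : rel {x : G | x \in S} :=
  fun x y => adj (val x) (val y).

Lemma induced_sym : symmetric induced_adj.
Proof. by move=> x y; apply: adj_sym. Qed.

Lemma induced_irrefl : irreflexive induced_adj.
Proof. by move=> x; apply: adj_irrefl. Qed.

Definition induced : sgraph := SGraph induced_sym induced_irrefl.
End Induced.

Section DisjointUnion.
Variables F G : sgraph.

Definition dunion_adj : rel (F + G)%type := fun u v =>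
  match u, v with
  | inl x, inl y => adj x y
  | inr x, inr y => adj x y
  | _, _ => false
  end.

Lemma dunion_sym : symmetric dunion_adj.
Proof. by move=> [x|x] [y|y] //=; apply: adj_sym. Qed.

Lemma dunion_irrefl : irreflexive dunion_adj.
Proof. by move=> [x|x] /=; apply: adj_irrefl. Qed.

Definition dunion : sgraph := SGraph dunion_sym dunion_irrefl.
End DisjointUnion.

(* The disjoint union of k copies of G; it has no vertices when k = 0. *)
Section Copies.
Variables (k : nat) (G : sgraph).

Definition copies_adj : rel ('I_k * G)%type :=
  fun u v => (u.1 == v.1) && adj u.2 v.2.

Lemma copies_sym : symmetric copies_adj.
Proof. by move=> u v; rewrite /copies_adj eq_sym adj_sym. Qed.

Lemma copies_irrefl : irreflexive copies_adj.
Proof. by move=> u; rewrite /copies_adj adj_irrefl andbF. Qed.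

Definition copies : sgraph := SGraph copies_sym copies_irrefl.
End Copies.

Definition covered (H G : sgraph) : Prop :=
  forall v : G, exists2 f : H -> G, embedding f & v \in codom f.

Definition edge_minimal (H : sgraph) (N : nat) (G : sgraph) : Prop :=
  [/\ #|G| = N, covered H G &
      forall G' : sgraph, #|G'| = N -> covered H G' -> nedges G <= nedges G'].

(* G[V] has the maximum number of edges among all subgraphs of H with m
   vertices, not only the induced ones. *)
Definition induces_densest_subgraph (H : sgraph) (m : nat) (G : sgraph)
    (V : {set G}) : Prop :=
  [/\ #|V| = m, contained (induced V) H &
      forall F : sgraph, #|F| = m -> contained F H ->
        nedges F <= nedges (induced V)].

(* Membership in the family L_{n+r}^H, where n = #|H| and r < n. *)
Definition in_L (H : sgraph) (r : nat) (G : sgraph) : Prop :=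
  exists V V1 V2 : {set G},
    [/\ [/\ V :|: V1 :|: V2 = [set: G],
            [disjoint V & V1], [disjoint V & V2] & [disjoint V1 & V2]],
        #|V1| = r /\ #|V2| = r,
        (forall x y, x \in V1 -> y \in V2 -> ~~ adj x y),
        induces_densest_subgraph H (#|H| - r) V &
        giso (induced (V1 :|: V)) H /\ giso (induced (V2 :|: V)) H].

Definition ideal_in_class (H : sgraph) (r : nat) : Prop :=
  forall q : nat, 0 < q -> forall G : sgraph,
    edge_minimal H (q * #|H| + r) G <->
    exists2 L : sgraph, in_L H r L & giso G (dunion L (copies (q - 1) H)).

Definition ideal (H : sgraph) : Prop :=
  forall r : nat, r < #|H| -> ideal_in_class H r.

(* d is the largest even number below (n - 1) / 2, written without fractions;
   if that integer is negative (n <= 1) no natural number d qualifies. *)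
Definition largest_even_below_half (n d : nat) : Prop :=
  [/\ ~~ odd d, 2 * d < n - 1 &
      forall m : nat, ~~ odd m -> 2 * m < n - 1 -> m <= d].

(* Main.v *)
Require Import Defs.
From mathcomp Require Import all_boot.
From mathcomp Require Import ssralg zmodp zify.

(* Write N = q n + r, count edges as ordered pairs, and let f(r) be the least
   number of edges leaving an r-subset of the d-regular graph H, n = |H|; put
   h(N) = N d + f(N mod n). When 2 d + 1 >= n, f is strictly subadditive. Hence
   adding a copy of H that brings s new vertices to a vertex set X adds at least
   h(|X| + s) - h(|X|) to the count, strictly more unless n divides |X| or s.
   So a covered graph on N vertices has count at least h(N), and if it attains
   h(N) then, however it is exhausted by copies of H, only one step can bring a
   number of new vertices that is not a multiple of n: two copies overlap in
   n - r vertices and the rest splits off as disjoint copies of H.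

   For tightness, take H to be a disjoint union of regular graphs F and G with
   |F| < |G| <= |F| + d. Then 3F + G is d-regular and covered, hence
   edge-minimal, but a d-regular member of L_{n+r} with r = 2|F| would have a
   union of components on only |G| - |F| <= d vertices. *)

Set Implicit Arguments.
Unset Strict Implicit.
Unset Printing Implicit Defensive.

(** * Counting adjacent ordered pairs *)

Definition arcs (T : finType) (e : rel T) (A B : {set T}) : nat :=
  \sum_(x in A) \sum_(y in B) e x y.

Section Arcs.
Variables (T : finType) (e : rel T).
Implicit Types (A B C : {set T}).

Lemma arcsC A B : symmetric e -> arcs e A B = arcs e B A.
Proof.
move=> sym_e; rewrite /arcs exchange_big; apply: eq_bigr => x _.
by apply: eq_bigr => y _; rewrite sym_e.
Qed.

Lemma arcsUl A B C : [disjoint A & B] ->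
  arcs e (A :|: B) C = arcs e A C + arcs e B C.
Proof. by move=> dAB; rewrite /arcs -bigU //; apply: eq_bigl => x; rewrite inE. Qed.

Lemma arcsUr A B C : [disjoint B & C] ->
  arcs e A (B :|: C) = arcs e A B + arcs e A C.
Proof.
move=> dBC; rewrite /arcs -big_split /=; apply: eq_bigr => x _.
by rewrite -bigU //; apply: eq_bigl => y; rewrite inE.
Qed.

Lemma arcsUU A B : symmetric e -> [disjoint A & B] ->
  arcs e (A :|: B) (A :|: B) = arcs e A A + 2 * arcs e B A + arcs e B B.
Proof.
by move=> sym_e dAB; rewrite arcsUl // !arcsUr // (arcsC A B) //; lia.
Qed.

Lemma arcs0l B : arcs e set0 B = 0.
Proof. by rewrite /arcs big_set0. Qed.

Lemma arcs1l x B : arcs e [set x] B = \sum_(y in B) e x y.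
Proof. by rewrite /arcs big_set1. Qed.

Lemma arcs_gt0 A B x y : x \in A -> y \in B -> e x y -> 0 < arcs e A B.
Proof. by move=> Ax By exy; rewrite /arcs (bigD1 x) //= (bigD1 y) //= exy. Qed.

Lemma arcs_eq0 A B : (forall x y, x \in A -> y \in B -> ~~ e x y) -> arcs e A B = 0.
Proof.
move=> nAB; rewrite /arcs big1 // => x Ax; rewrite big1 // => y By.
by rewrite (negPf (nAB x y Ax By)).
Qed.

Lemma arcs_setD1 A x : symmetric e -> irreflexive e -> x \in A ->
  arcs e A A = arcs e (A :\ x) (A :\ x) + 2 * arcs e [set x] A.
Proof.
move=> sym_e irr_e Ax; have dx : [disjoint A :\ x & [set x]].
  by rewrite disjoints_subset; apply/subsetP=> y; rewrite !inE => /andP[].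
rewrite -{1 2 5}(setD1K Ax) setUC arcsUU // (arcsUr _ dx).
by rewrite (_ : arcs e [set x] [set x] = 0) ?arcs1l ?big_set1 ?irr_e //; lia.
Qed.

(** Each adjacent ordered pair inside [A] survives the deletion of any vertex of [A] other than its
    two ends. *)
Lemma sum_arcs_setD1 A : symmetric e -> irreflexive e ->
  \sum_(x in A) arcs e (A :\ x) (A :\ x) + 2 * arcs e A A = #|A| * arcs e A A.
Proof.
move=> sym_e irr_e; rewrite -sum_nat_const {2}/arcs big_distrr -big_split /=.
by apply: eq_bigr => x Ax; rewrite (arcs_setD1 sym_e irr_e Ax) arcs1l.
Qed.

(* Deleting a suitable vertex preserves the inequality
   (t - 1) arcs(U, U) < 2 (|U| - 1) w(U): both sides are averaged over the
   deleted vertex, and lose the factors (|U| - 2) / |U|. *)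
Lemma exists_sparse_subset (w : T -> nat) (t : nat) (U : {set T}) :
    symmetric e -> irreflexive e -> 1 < t <= #|U| ->
    (t - 1) * arcs e U U < 2 * (#|U| - 1) * \sum_(x in U) w x ->
  exists A : {set T}, [/\ A \subset U, #|A| = t & arcs e A A < 2 * \sum_(x in A) w x].
Proof.
move=> sym_e irr_e /andP[t_gt1].
elim: {U}_.+1 {-2}U (ltnSn #|U|) => // k IHk U leUk; rewrite leq_eqVlt => /orP[/eqP-> ltU|lttU ltU].
  by exists U; split=> //; nia.
have [/exists_inP[x Ux ltUx]|] := boolP [exists x in U,
    (t - 1) * arcs e (U :\ x) (U :\ x) < 2 * (#|U :\ x| - 1) * \sum_(y in U :\ x) w y].
  have cardU := cardsD1 x U; rewrite Ux in cardU.
  have [||A [sAU cardA ltA]] := IHk _ _ _ ltUx; [lia|lia|].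
  by exists A; split=> //; apply: subset_trans sAU (subsetDl _ _).
rewrite negb_exists => /forallP nex.
have : 2 * (#|U| - 2) * (\sum_(x in U) \sum_(y in U :\ x) w y)
       <= (t - 1) * \sum_(x in U) arcs e (U :\ x) (U :\ x).
  rewrite !big_distrr /=; apply: leq_sum => x Ux.
  have := nex x; rewrite Ux /= -leqNgt.
  have cardU := cardsD1 x U; rewrite Ux in cardU.
  by rewrite (_ : #|U :\ x| - 1 = #|U| - 2) //; lia.
have := sum_arcs_setD1 U sym_e irr_e.
have : \sum_(x in U) \sum_(y in U :\ x) w y + \sum_(x in U) w x = #|U| * \sum_(x in U) w x.
  rewrite -sum_nat_const -big_split /=; apply: eq_bigr => x Ux.
  by rewrite [RHS](big_setD1 x) //= addnC.
move: ltU lttU; set a := arcs e U U; set W := (\sum_(x in U) w x).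
set a' := (\sum_(x in U) arcs e (U :\ x) (U :\ x)); set W' := (\sum_(x in U) \sum_(y in U :\ x) w y).
move=> ltU lttU eW ea le'.
(* Here [#|U| > t >= 2], so the factor [#|U| - 2], now [u.+1], is positive and can be cancelled. *)
have [u eu] : exists u, #|U| = u.+3 by exists (#|U| - 3); lia.
rewrite {}eu in ltU ea eW le'.
have eW' : W' = u.+2 * W by lia.
have ea' : a' = u.+1 * a by lia.
have : u.+1 * ((t - 1) * a) < u.+1 * (2 * u.+2 * W).
  by rewrite ltn_pmul2l //; lia.
move: le'; rewrite ea' eW' (_ : u.+3 - 2 = u.+1) ?subSS ?subn0 //; nia.
Qed.

End Arcs.

Lemma arcs_imset (S T : finType) (f : S -> T) (e : rel T) (A B : {set S}) :
  injective f -> arcs e (f @: A) (f @: B) = arcs (fun x y => e (f x) (f y)) A B.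
Proof.
move=> inj_f; rewrite /arcs big_imset /=; last by move=> ? ? _ _; apply: inj_f.
by apply: eq_bigr => x _; rewrite big_imset //= => ? ? _ _; apply: inj_f.
Qed.

Lemma leq_arcs (T : finType) (e e' : rel T) (A A' B B' : {set T}) :
  A \subset A' -> B \subset B' -> (forall x y, e x y -> e' x y) ->
  arcs e A B <= arcs e' A' B'.
Proof.
move=> sA sB le_e.
have leB x : \sum_(y in B) e x y <= \sum_(y in B') e' x y.
  rewrite [leqRHS](big_setID B) (setIidPr sB) /=; apply: leq_trans (leq_addr _ _).
  by apply: leq_sum => y _; have := le_e x y; case: (e x y) => // ->.
rewrite /arcs [leqRHS](big_setID A) (setIidPr sA) /=.
by apply: leq_trans (leq_addr _ _); apply: leq_sum.
Qed.

Lemma eq_arcs (T : finType) (e e' : rel T) (A B : {set T}) :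
  e =2 e' -> arcs e A B = arcs e' A B.
Proof. by move=> ee'; apply: eq_bigr => x _; apply: eq_bigr => y _; rewrite ee'. Qed.

Lemma arcsT_eq (T : finType) (e e' : rel T) :
  (forall x y, e x y -> e' x y) ->
  arcs e' setT setT <= arcs e setT setT -> e =2 e'.
Proof.
move=> le_e le' x y; apply/idP/idP => [|e'xy]; first exact: le_e.
apply: contraLR le'; rewrite -ltnNge => nexy.
rewrite /arcs (bigD1 x) // [ltnRHS](bigD1 x) //= -addSn; apply: leq_add.
  rewrite (bigD1 y) // [ltnRHS](bigD1 y) //= (negPf nexy) e'xy ltnS add0n.
  by apply: leq_sum => z _; have := le_e x z; case: (e x z) => // ->.
apply: leq_sum => z _; apply: leq_sum => u _.
by have := le_e z u; case: (e z u) => // ->.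
Qed.

(** Incidences are counted in two ways: an edge has two ends, and the edges at [x] correspond to the
    neighbours [y] of [x] through [[set x; y]]. *)
Lemma nedges_arcs (G : sgraph) : 2 * nedges G = arcs (@adj G) setT setT.
Proof.
have card_edge (E : {set G}) : E \in edges G -> #|E| = 2.
  case/imset2P=> x y _; rewrite inE => /andP[_ xy] ->; rewrite cards2.
  by case: eqP xy => // ->; rewrite adj_irrefl.
rewrite mulnC -sum_nat_const -(eq_bigr _ card_edge).
under eq_bigr do rewrite -sum1_card.
rewrite (exchange_big_dep xpredT) //= /arcs; apply: eq_big => [x|x _]; first by rewrite inE.
transitivity (#|[set y | adj x y]|); last first.
  by rewrite -sum1_card big_mkcond [RHS]big_mkcond; apply: eq_bigr => y _; rewrite !inE; case: adj.
rewrite sum1_card.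
rewrite -(card_in_imset (f := fun y => [set x; y])); last first.
  move=> y z xy xz eyz; have: y \in [set x; z] by rewrite -eyz !inE eqxx orbT.
  rewrite !inE => /orP[/eqP eyx|/eqP//].
  by move: xy; rewrite inE eyx adj_irrefl.
apply: eq_card => E; rewrite unfold_in /=; apply/andP/imsetP => [[/imset2P[y z _]]|[y xy ->]].
  rewrite inE => /andP[_ yz] ->; rewrite !inE => /orP[]/eqP->.
    by exists z; rewrite ?inE.
  by exists y; rewrite ?inE 1?adj_sym // setUC.
rewrite inE in xy; split; last by rewrite !inE eqxx.
by apply/imset2P; exists x y; rewrite ?inE.
Qed.

(** * Minimum cuts of a dense regular graph *)

Definition nonadj (G : sgraph) : rel G := fun x y => (x != y) && ~~ adj x y.

Definition maxarcs (H : sgraph) (m : nat) : nat :=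
  \max_(A : {set H} | #|A| == m) arcs adj A A.

(** The f of the overview: in a [d]-regular graph an [m]-set [A] sends [m * d - arcs adj A A] edges
    outside. [cutminE] shows that the subtraction does not truncate there. *)
Definition cutmin (H : sgraph) (d m : nat) : nat := m * d - maxarcs H m.

Lemma arcs_nonadj (G : sgraph) (A : {set G}) :
  arcs adj A A + arcs (@nonadj G) A A = #|A| * (#|A| - 1).
Proof.
rewrite /arcs -big_split /= -sum_nat_const; apply: eq_bigr => x Ax.
rewrite -big_split /= (bigD1 x) //= adj_irrefl /nonadj eqxx add0n.
rewrite (eq_bigr (fun=> 1)) => [|y /andP[_ yx]]; last by rewrite eq_sym yx; case: adj.
rewrite sum1_card (cardsD1 x A) Ax addKn.
by apply: eq_card => y; rewrite !inE unfold_in andbC.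
Qed.

Lemma leq_maxarcs (H : sgraph) (A : {set H}) : arcs adj A A <= maxarcs H #|A|.
Proof. by rewrite /maxarcs (bigD1 A) //= leq_maxl. Qed.

Lemma maxarcs_attained (H : sgraph) (m : nat) : m <= #|H| ->
  exists2 A : {set H}, #|A| = m & arcs adj A A = maxarcs H m.
Proof.
move=> le_m; have : 0 < #|[pred A : {set H} | #|A| == m]|.
  have := card_draws H m; rewrite cardsE => ->; by rewrite bin_gt0.
case/(eq_bigmax_cond (fun A : {set H} => arcs adj A A)) => A /eqP cardA eqA.
by exists A.
Qed.

Lemma maxarcs_le_pairs (H : sgraph) (m : nat) : maxarcs H m <= m * (m - 1).
Proof. by apply/bigmax_leqP => A /eqP <-; rewrite -arcs_nonadj leq_addr. Qed.

Lemma arcs_degree (G : sgraph) (A : {set G}) :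
  arcs adj A setT = \sum_(x in A) #|[set y | adj x y]|.
Proof.
apply: eq_bigr => x _; rewrite -sum1_card big_mkcond [RHS]big_mkcond.
by apply: eq_bigr => y _; rewrite !inE; case: adj.
Qed.

Lemma arcsT (G : sgraph) (d : nat) (A : {set G}) :
  regular d G -> arcs adj A setT = #|A| * d.
Proof.
by move=> regG; rewrite arcs_degree -sum_nat_const; apply: eq_bigr => x _.
Qed.

Section Regular.
Variables (H : sgraph) (d : nat).
Hypothesis regH : regular d H.
Implicit Types A S : {set H}.

Lemma arcs_split A S : A \subset S -> arcs adj A S = arcs adj A A + arcs adj A (S :\: A).
Proof.
move=> sAS; rewrite -arcsUr ?setDE; last first.
  by rewrite disjoints_subset setCI setCK subsetUr.
by rewrite -setDE -{1}(setID S A) (setIidPr sAS).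
Qed.

Lemma arcs_setC A : arcs adj A A + arcs adj A (~: A) = #|A| * d.
Proof. by rewrite -(arcsT _ regH) -setTD -arcs_split ?subsetT. Qed.

(** A set and its complement have the same cut, which cancels when their degree sums are
    compared. *)
Lemma arcs_setCC A :
  arcs adj (~: A) (~: A) + 2 * (#|A| * d) = #|H| * d + arcs adj A A.
Proof.
have := arcs_setC A; have := arcs_setC (~: A); rewrite setCK.
rewrite (arcsC (~: A) A (@adj_sym H)) => e1 e2; have := cardsC A; nia.
Qed.

Lemma maxarcs_le m : maxarcs H m <= m * d.
Proof. by apply/bigmax_leqP => A /eqP <-; rewrite -arcs_setC leq_addr. Qed.

Lemma cutminE m : cutmin H d m + maxarcs H m = m * d.
Proof. by rewrite subnK // maxarcs_le. Qed.

Lemma maxarcs_compl m : m <= #|H| ->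
  maxarcs H (#|H| - m) + 2 * (m * d) = #|H| * d + maxarcs H m.
Proof.
move=> le_m; apply/eqP; rewrite eqn_leq; apply/andP; split.
  have [A cardA <-] := maxarcs_attained (leq_subr m #|H|).
  have := arcs_setCC A; have := leq_maxarcs (~: A).
  have -> : #|~: A| = m by have := cardsC A; lia.
  by rewrite cardA; nia.
have [A cardA <-] := maxarcs_attained le_m.
rewrite -arcs_setCC cardA leq_add2r; apply: leq_trans (leq_maxarcs _) _.
by rewrite (_ : #|~: A| = #|H| - m) //; have := cardsC A; lia.
Qed.

Lemma cutmin_compl m : m <= #|H| -> cutmin H d (#|H| - m) = cutmin H d m.
Proof.
move=> le_m; have := maxarcs_compl le_m; have := cutminE m; have := cutminE (#|H| - m).
nia.
Qed.

Lemma cutmin0 : cutmin H d 0 = 0.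
Proof. by rewrite /cutmin mul0n. Qed.

(** A vertex of [A] has at most [#|A| - 1] neighbours inside [A], hence at least [d + 1 - #|A|]
    outside. *)
Lemma cut_ge A : #|A| * (d + 1 - #|A|) <= arcs adj A (~: A).
Proof.
have := arcs_setC A; have := arcs_nonadj A.
have [le_Ad|] := leqP #|A| d; last by move/eqP => /eqP; rewrite /leq; nia.
have [//|A_gt0] := posnP #|A|; first by move->.
nia.
Qed.

Hypothesis dense : #|H| <= 2 * d + 1.

(** Connectedness of [H]: by density one of [A] and [~: A] has at most [d] vertices, and [cut_ge] is
    positive for that one. *)
Lemma cut_gt0 A : 0 < #|A| < #|H| -> 0 < arcs adj A (~: A).
Proof.
case/andP=> A_gt0 ltA; have := cut_ge A; have := cut_ge (~: A).
rewrite setCK (arcsC (~: A) A (@adj_sym H)); have := cardsC A.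
have [le_Ad _ _|lt_dA eA le_cut _] := leqP #|A| d.
  by apply: leq_trans; rewrite muln_gt0; lia.
by apply: leq_trans le_cut; rewrite muln_gt0; lia.
Qed.

(** [S] is enlarged by a [t]-set [A] outside it that has fewer non-adjacent ordered pairs than twice
    its edges to [S]; the gain then exceeds the [t * (t - 1)] pairs of a clique. For [t > 1] such an
    [A] is found by averaging over [~: S], the weight of a vertex being its number of neighbours in
    [S]. *)
Lemma add_vertices S t : 0 < t <= #|S| -> #|S| + t <= #|H| ->
  exists2 S' : {set H}, #|S'| = #|S| + t & arcs adj S S + t * (t - 1) < arcs adj S' S'.
Proof.
move=> /andP[t_gt0 le_tS] le_StH.
suff [A [sAU cardA ltA]] : exists A : {set H}, [/\ A \subset ~: S, #|A| = t
    & arcs (@nonadj H) A A < 2 * arcs adj A S].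
  have dSA : [disjoint S & A] by rewrite disjoint_sym disjoints_subset.
  exists (S :|: A); first by rewrite cardsU disjoint_setI0 // cards0; lia.
  rewrite (arcsUU (@adj_sym H) dSA); have := arcs_nonadj A; rewrite cardA; lia.
have cut0 : 0 < arcs adj S (~: S) by apply: cut_gt0; lia.
have cardU := cardsC S.
have [t_le1|t_gt1] := leqP t 1.
  have [x xS /existsP[y /andP[yS xy]]] : exists2 x, x \notin S & [exists y, (y \in S) && adj x y].
    apply/exists_inP; apply: contraTT cut0; rewrite negb_exists_in => /forall_inP nex.
    rewrite -leqNgt leqn0 arcs_eq0 // => y x yS; rewrite inE => xS.
    have := nex x xS; rewrite negb_exists => /forallP/(_ y).
    by rewrite yS adj_sym.
  exists [set x]; split; [by rewrite sub1set inE|by rewrite cards1; lia|].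
  have := arcs_gt0 (set11 x) yS xy.
  rewrite (@arcs_eq0 _ _ [set x] [set x]); first by lia.
  by move=> u v /set1P-> /set1P->; rewrite /nonadj eqxx.
apply: (exists_sparse_subset (w := fun x => \sum_(y in S) adj x y)).
- by move=> x y; rewrite /nonadj eq_sym adj_sym.
- by move=> x; rewrite /nonadj eqxx.
- by lia.
rewrite -/(arcs adj (~: S) S) (arcsC _ S (@adj_sym H)).
have := arcs_nonadj (~: S); have := arcs_setC (~: S); rewrite setCK.
rewrite (arcsC _ S (@adj_sym H)); have := cut_ge S.
move: cut0; set f := arcs adj S (~: S); set u := #|~: S|.
set a := arcs adj _ _; set b := arcs _ _ _ => f_gt0 lef ea eb.
(* It remains to see that [(t - 1) * b < 2 * (u - 1) * f]. Over the integers the degree sum gives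
   [b = u * (u - 1 - d) + f], so [b <= f] as long as [u <= d + 1]. *)
have [le_ud|lt_du] := leqP u (d + 1).
  have : b <= f by nia.
  nia.
have le_Sd : #|S| <= d by lia.
have ub : b + u * d = u * (u - 1) + f by lia.
have eb' : b = u * (u - 1 - d) + f by nia.
(* Density gives [u - 1 - d <= d - #|S|], and [#|S| * (d - #|S|)] lies strictly below the bound of
   [cut_ge] for [S]. *)
have lt_kf : (t - 1) * (u - 1 - d) < f.
  apply: leq_trans lef; apply: (@leq_ltn_trans (#|S| * (d - #|S|))).
    by apply: leq_mul; lia.
  by rewrite ltn_pmul2l; lia.
have le_fu : (u + (t - 1)) * f <= 2 * (u - 1) * f by rewrite leq_mul2r; lia.
apply: leq_trans le_fu; rewrite eb' mulnDr mulnDl ltn_add2r mulnCA.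
by rewrite ltn_pmul2l //; lia.
Qed.

(** With [t <= s], a densest [s]-set is enlarged by [add_vertices]. The gain beats [t * (t - 1)],
    and a densest [t]-set has at most that many pairs. *)
Lemma cutmin_add s t : 0 < s -> 0 < t -> s + t <= #|H| ->
  cutmin H d (s + t) < cutmin H d s + cutmin H d t.
Proof.
wlog le_ts : s t / t <= s => [IH|] s_gt0 t_gt0 le_st.
  by case: (leqP t s) => [|/ltnW] ?; [|rewrite addnC [ltnRHS]addnC]; apply: IH => //; lia.
have [S cardS eS] := maxarcs_attained (leq_trans (leq_addr t s) le_st).
have [||S' cardS' lt_S'] := @add_vertices S t; rewrite ?cardS ?t_gt0 //.
have := leq_maxarcs S'; have := maxarcs_le_pairs H t.
have := cutminE s; have := cutminE t; have := cutminE (s + t).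
by rewrite cardS' cardS; nia.
Qed.

End Regular.

(** * Graphs covered by copies of a dense regular graph *)

(** The h of the overview. It bounds a count of ordered pairs, hence twice a number of edges. *)
Definition minarcs (H : sgraph) (d N : nat) : nat :=
  N * d + cutmin H d (N %% #|H|).

Definition copy_of (F G : sgraph) (C : {set G}) : Prop :=
  exists2 f : F -> G, embedding f & C = f @: setT.

Lemma card_copy (F G : sgraph) (C : {set G}) : copy_of F C -> #|C| = #|F|.
Proof. by case=> f [inj_f _] ->; rewrite card_imset // cardsT. Qed.

Lemma covered_copy (F G : sgraph) (x : G) : covered F G ->
  exists2 C : {set G}, copy_of F C & x \in C.
Proof.
move=> /(_ x)[f emb_f /codomP[y ->]]; exists (f @: setT); first by exists f.
exact: imset_f.
Qed.

Lemma card_setU_diff (T : finType) (A B : {set T}) : #|A :|: B| = #|A| + #|B :\: A|.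
Proof. by have := cardsUI A B; have := cardsID A B; rewrite setIC; lia. Qed.

Lemma setU_diff (T : finType) (A B : {set T}) : A :|: B = A :|: (B :\: A).
Proof. by apply/setP=> x; rewrite !inE; case: (x \in A). Qed.

Lemma disjoint_diff (T : finType) (A B : {set T}) : [disjoint A & B :\: A].
Proof. by rewrite disjoint_sym disjoints_subset setDE subsetIr. Qed.

Section Covers.
Variables (H : sgraph) (d : nat).
Hypothesis regH : regular d H.
Hypothesis dense : #|H| <= 2 * d + 1.
Hypothesis H_gt0 : 0 < #|H|.

Lemma cutmin_mod_add_lt a b : ~~ (#|H| %| a) -> ~~ (#|H| %| b) ->
  cutmin H d ((a + b) %% #|H|) < cutmin H d (a %% #|H|) + cutmin H d (b %% #|H|).
Proof.
rewrite /dvdn -!lt0n -(modnDm a b).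
have := ltn_pmod a H_gt0; have := ltn_pmod b H_gt0.
move: (a %% #|H|) (b %% #|H|) => s t lt_t lt_s s_gt0 t_gt0.
have [le_st|lt_st] := leqP (s + t) #|H|.
  have := cutmin_add regH dense s_gt0 t_gt0 le_st.
  case: (eqVneq (s + t) #|H|) => [->|ne]; first by rewrite modnn cutmin0; lia.
  by rewrite modn_small // ltn_neqAle ne.
(* For [s + t > #|H|] one passes to complements: [#|H| - s] and [#|H| - t] are positive with sum
   below [#|H|], and [cutmin] does not change. *)
have -> : (s + t) %% #|H| = #|H| - ((#|H| - s) + (#|H| - t)).
  by rewrite -{1}(subnK (ltnW lt_st)) modnDr modn_small; lia.
rewrite cutmin_compl //; last by lia.
rewrite -(cutmin_compl regH (ltnW lt_s)) -(cutmin_compl regH (ltnW lt_t)).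
by apply: (cutmin_add regH dense); lia.
Qed.

Lemma cutmin_mod_add_le a b :
  cutmin H d ((a + b) %% #|H|) <= cutmin H d (a %% #|H|) + cutmin H d (b %% #|H|).
Proof.
have [|na] := boolP (#|H| %| a).
  by move/eqP=> a0; rewrite -modnDml a0 add0n cutmin0 leq_addl.
have [|nb] := boolP (#|H| %| b).
  by move/eqP=> b0; rewrite -modnDmr b0 addn0 cutmin0 leq_addr.
exact/ltnW/cutmin_mod_add_lt.
Qed.

Lemma cutmin_modn m : m <= #|H| -> cutmin H d (m %% #|H|) = cutmin H d m.
Proof.
rewrite leq_eqVlt => /orP[/eqP->|/modn_small-> //].
by rewrite modnn -(cutmin_compl regH (leqnn _)) subnn.
Qed.

Section Graph.
Variable G : sgraph.
Implicit Types X C : {set G}.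

(** Let [S0] be the part of [H] sent outside [X], of size s. Its edges to the rest of [H] count in
    both orders, so with its inner pairs it contributes at least [2 * s * d - arcs adj S0 S0], and
    this is at least [minarcs H d s]. *)
Lemma arcs_copy_ge X C : copy_of H C ->
  arcs adj X X + minarcs H d #|C :\: X| <= arcs adj (X :|: C) (X :|: C).
Proof.
move=> copyC; have cardC := card_copy copyC; case: copyC => f [inj_f emb_f] defC.
have leC : #|C :\: X| <= #|H| by rewrite -cardC subset_leq_card ?subsetDl.
rewrite /minarcs cutmin_modn // setU_diff arcsUU ?disjoint_diff //; last exact: adj_sym.
pose S0 := ~: (f @^-1: X).
have defS : C :\: X = f @: S0.
  apply/setP=> y; rewrite defC inE; apply/andP/imsetP => [[yX /imsetP[x _ eyx]]|[x xS ->]].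
    by exists x; rewrite // !inE -eyx.
  by rewrite imset_f //; move: xS; rewrite !inE.
have sub0 : f @: (~: S0) \subset X.
  by apply/subsetP=> _ /imsetP[x xS ->]; move: xS; rewrite !inE negbK.
have cardS : #|C :\: X| = #|S0| by rewrite defS card_imset.
rewrite cardS.
have h1 : arcs adj S0 (~: S0) <= arcs adj (C :\: X) X.
  apply: leq_trans (leq_arcs (subxx (C :\: X)) sub0 (fun _ _ => id)).
  by rewrite defS arcs_imset //; apply: leq_arcs.
have h2 : arcs adj S0 S0 <= arcs adj (C :\: X) (C :\: X).
  by rewrite defS arcs_imset //; apply: leq_arcs.
have := arcs_setC regH S0; have := leq_maxarcs S0; have := cutminE regH #|S0|; lia.
Qed.

(** In a form without subtraction: the difference [arcs adj X X - minarcs H d #|X|] does not drop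
    when a copy is added. *)
Lemma minarcs_add_copy X C : copy_of H C ->
  arcs adj X X + minarcs H d #|X :|: C| <= arcs adj (X :|: C) (X :|: C) + minarcs H d #|X|.
Proof.
move=> copyC; have := arcs_copy_ge X copyC; rewrite card_setU_diff /minarcs.
by have := cutmin_mod_add_le #|X| #|C :\: X|; lia.
Qed.

Lemma minarcs_add_copy_lt X C : copy_of H C ->
  ~~ (#|H| %| #|X|) -> ~~ (#|H| %| #|C :\: X|) ->
  arcs adj X X + minarcs H d #|X :|: C| < arcs adj (X :|: C) (X :|: C) + minarcs H d #|X|.
Proof.
move=> copyC nX nC; have := arcs_copy_ge X copyC; rewrite card_setU_diff /minarcs.
by have := cutmin_mod_add_lt nX nC; lia.
Qed.

Hypothesis covG : covered H G.

(** Copies through missing vertices are added to [X] until all of [G] is reached; the difference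
    never drops on the way. *)
Lemma minarcs_cover X :
  arcs adj X X + minarcs H d #|G| <= arcs (@adj G) setT setT + minarcs H d #|X|.
Proof.
elim: {X}_.+1 {-2}X (ltnSn #|~: X|) => // k IHk X ltk.
have [->|] := eqVneq X setT; first by rewrite cardsT.
rewrite eqEsubset subsetT /= => /subsetPn[x _ xX].
have [C copyC Cx] := covered_copy x covG.
have := minarcs_add_copy X copyC.
have diff_gt0 : 0 < #|C :\: X| by apply/card_gt0P; exists x; rewrite inE xX.
have := cardsC X; have := cardsC (X :|: C); have := card_setU_diff X C => eU eXC eX.
have /IHk : #|~: (X :|: C)| < k by lia.
by move: (minarcs _ _ _) (minarcs _ _ _) (minarcs _ _ _); lia.
Qed.

Lemma minarcs_le : minarcs H d #|G| <= arcs (@adj G) setT setT.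
Proof.
have := minarcs_cover set0; rewrite cards0 {2}/minarcs mod0n cutmin0.
by rewrite arcs0l; lia.
Qed.

(** * Structure of the covered graphs that attain the bound *)

Section Tight.
Hypothesis minG : arcs (@adj G) setT setT = minarcs H d #|G|.

Definition tight X := arcs adj X X = minarcs H d #|X|.

Lemma tight0 : tight set0.
Proof. by rewrite /tight arcs0l cards0 /minarcs mod0n cutmin0. Qed.

(** The difference between count and bound is zero at [X] and at [G], and it cannot drop in
    between. *)
Lemma tight_add_copy X C : copy_of H C -> tight X -> tight (X :|: C).
Proof.
move=> copyC tX; have := minarcs_cover (X :|: C); have := minarcs_add_copy X copyC.
by rewrite minG tX /tight; lia.
Qed.

Lemma tight_copy C : copy_of H C -> tight C.
Proof. by move=> copyC; rewrite -[C]set0U; apply: tight_add_copy tight0. Qed.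

Lemma tight_dvd X C : copy_of H C -> tight X ->
  (#|H| %| #|X|) || (#|H| %| #|C :\: X|).
Proof.
move=> copyC tX; apply/norP=> -[nX nC].
have := minarcs_add_copy_lt copyC nX nC; rewrite tX (tight_add_copy copyC tX); lia.
Qed.

(** Once [#|X|] is not a multiple of [#|H|], every further copy brings a multiple of [#|H|] by
    [tight_dvd], so the residue is frozen until [G] is exhausted. *)
Lemma tight_cardN X : tight X -> ~~ (#|H| %| #|X|) -> #|X| = #|G| %[mod #|H|].
Proof.
elim: {X}_.+1 {-2}X (ltnSn #|~: X|) => // k IHk X ltk tX nX.
have [->|] := eqVneq X setT; first by rewrite cardsT.
rewrite eqEsubset subsetT /= => /subsetPn[x _ xX].
have [C copyC Cx] := covered_copy x covG.
have := tight_dvd copyC tX; rewrite (negPf nX) /= => dvC.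
have cardXC := card_setU_diff X C.
have diff_gt0 : 0 < #|C :\: X| by apply/card_gt0P; exists x; rewrite inE xX.
rewrite -(IHk (X :|: C)) ?cardXC.
- by rewrite -modnDmr (eqP dvC) addn0.
- by have := cardsC X; have := cardsC (X :|: C); lia.
- exact: tight_add_copy.
by rewrite dvdn_addl.
Qed.

(** The case to settle is that [#|H|] divides [#|X|], hence [#|G|]: if it did not divide
    [#|X :|: C|], that size would have the residue of [#|G|], which is 0. *)
Lemma tight_diff_dvd X C : copy_of H C -> tight X -> #|X| = #|G| %[mod #|H|] ->
  #|H| %| #|C :\: X|.
Proof.
move=> copyC tX eqX; case/orP: (tight_dvd copyC tX) => // dvX.
have [dvXC|nXC] := boolP (#|H| %| #|X :|: C|).
  by move: dvXC; rewrite card_setU_diff dvdn_addr.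
have := tight_cardN (tight_add_copy copyC tX) nXC; rewrite -eqX (eqP dvX) => eq0.
by rewrite /dvdn eq0 in nXC.
Qed.

(** One copy [C x] is chosen through each vertex [x]. Two distinct chosen copies that meet form the
    pair, with the residue forced by [tight_cardN]. If there are none, the chosen copies partition
    [G], so [#|H|] divides [#|G|]; in that case two equal copies serve. *)
Lemma exists_overlap : #|H| <= #|G| -> exists A B : {set G},
  [/\ copy_of H A, copy_of H B & #|B :\: A| = #|G| %% #|H|].
Proof.
move=> le_HG.
have [C copyC xC] := fin_all_exists2 (fun x => covered_copy x covG).
have [N0|nN] := boolP (#|H| %| #|G|).
  have /card_gt0P[x _] : 0 < #|G| by apply: leq_trans le_HG.
  by exists (C x), (C x); split=> //; rewrite setDv cards0 (eqP N0).
have [/existsP[x /existsP[y /andP[ndis nsub]]]|] :=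
    boolP [exists x, exists y, ~~ [disjoint C y & C x] && ~~ (C y \subset C x)].
  exists (C x), (C y); split=> //.
  have tU := tight_add_copy (copyC y) (tight_copy (copyC x)).
  have gt0 : 0 < #|C y :\: C x| by rewrite card_gt0 setD_eq0.
  have ltn : #|C y :\: C x| < #|H|.
    move: ndis; rewrite -setI_eq0 -card_gt0 -(card_copy (copyC y)).
    by rewrite -(cardsID (C x) (C y)); lia.
  have := tight_cardN tU; rewrite card_setU_diff (card_copy (copyC x)).
  by rewrite /dvdn modnDl modn_small // -lt0n => ->.
rewrite negb_exists => /forallP all_dis; case/negP: nN.
have same x y z : z \in C x -> z \in C y -> C x = C y.
  move=> zx zy; have := all_dis x; rewrite negb_exists => /forallP/(_ y).
  rewrite negb_and !negbK => /orP[dis|]; first by rewrite (disjointFr dis zy) in zx.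
  move=> sub; apply/esym/eqP; rewrite eqEcard sub.
  by rewrite (card_copy (copyC x)) (card_copy (copyC y)) leqnn.
have : partition [set C x | x : G] setT.
  apply/and3P; split.
  - rewrite eqEsubset subsetT; apply/subsetP=> x _; apply/bigcupP.
    by exists (C x); rewrite ?xC ?imset_f.
  - apply/trivIsetP=> _ _ /imsetP[x _ ->] /imsetP[y _ ->] neC.
    apply: contraNT neC; rewrite -setI_eq0 => /set0Pn[z /setIP[zx zy]].
    exact/eqP/(same x y z).
  by apply/imsetP=> -[x _ e0]; have := xC x; rewrite -e0 inE.
move/(@card_uniform_partition _ #|H|); rewrite cardsT => -> ; first exact: dvdn_mull.
by move=> _ /imsetP[x _ ->]; apply: card_copy.
Qed.

(** A copy is tight, so it carries exactly [#|H| * d] ordered pairs, as many as [H] itself; no room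
    is left for an additional edge. *)
Lemma copy_induced (f : H -> G) x y :
  embedding f -> adj (f x) (f y) = adj x y.
Proof.
move=> [inj_f emb_f]; have copyf : copy_of H (f @: setT) by exists f.
have := tight_copy copyf; rewrite /tight arcs_imset // (card_copy copyf).
rewrite /minarcs modnn cutmin0 addn0 -cardsT -(arcsT _ regH) => eqT.
by rewrite (arcsT_eq emb_f) ?eqT.
Qed.

(** Copies are peeled off one at a time: a copy through a vertex outside [X] brings a positive
    multiple of [#|H|] new vertices, so it is disjoint from [X]. Indexing by [nat] lets a copy be
    put in front by a shift; [f0] is the default value for [k = 0]. *)
Lemma split_disjoint_copies (f0 : H -> G) (k : nat) X :
  tight X -> #|X| + k * #|H| = #|G| ->
  exists g : nat -> H -> G,
  [/\ forall i u, i < k -> g i u \notin X,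
      forall x i u, i < k -> x \in X -> ~~ adj x (g i u),
      forall i j u v, i < k -> j < k -> g i u = g j v -> (i, u) = (j, v)
    & forall i j u v, i < k -> j < k -> adj (g i u) (g j v) = (i == j) && adj u v].
Proof.
elim: k X => [|k IHk] X tX cardX; first by exists (fun=> f0).
have [eX|] := eqVneq X setT; first by move: cardX; rewrite eX cardsT; lia.
rewrite eqEsubset subsetT /= => /subsetPn[x _ xX].
have [C copyC Cx] := covered_copy x covG.
have dvC : #|H| %| #|C :\: X|.
  by apply: tight_diff_dvd => //; rewrite -cardX addnC modnMDl.
have cardC := card_copy copyC.
have CX : C :\: X = C.
  apply/eqP; rewrite eqEcard subsetDl cardC dvdn_leq //.
  by apply/card_gt0P; exists x; rewrite inE xX.
have dXC : [disjoint X & C] by rewrite -CX disjoint_diff.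
have tXC := tight_add_copy copyC tX.
have cardXC : #|X :|: C| = #|X| + #|H| by rewrite card_setU_diff CX cardC.
(* [minarcs] grows by exactly [#|H| * d] from [X] to [X :|: C], which the pairs inside [C] use
   up. *)
have noXC y z : y \in X -> z \in C -> ~~ adj y z.
  move=> Xy Cz; apply/negP=> yz; have := @arcs_gt0 _ adj _ _ _ _ Cz Xy.
  rewrite adj_sym => /(_ yz); move: (tight_copy copyC) tX tXC.
  rewrite /tight arcsUU //; last exact: adj_sym.
  by rewrite cardXC cardC /minarcs modnDr modnn cutmin0; lia.
have [|g [gX gadj ginj giso]] := IHk _ tXC; first by rewrite cardXC; lia.
case: copyC => f emb_f defC; have Cf u : f u \in C by rewrite defC imset_f.
have [inj_f _] := emb_f.
have gC i u : i < k -> g i u \notin C.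
  by move/(gX i u); rewrite inE negb_or => /andP[].
have nadj i u v : i < k -> ~~ adj (f u) (g i v).
  by move=> lt_ik; apply: gadj; rewrite // inE Cf orbT.
exists (fun i => if i is i'.+1 then g i' else f); split.
- case=> [|i] u lt_i; last by have := gX i u lt_i; rewrite inE negb_or => /andP[].
  by apply/negP=> Xfu; have := disjointFr dXC Xfu; rewrite Cf.
- by move=> y [|i] u lt_i Xy; [apply: noXC | apply: gadj; rewrite // inE Xy].
- move=> [|i] [|j] u v lt_i lt_j e.
  + by rewrite (inj_f _ _ e).
  + by have := gC j v lt_j; rewrite -e Cf.
  + by have := gC i u lt_i; rewrite e Cf.
  by case: (ginj _ _ _ _ lt_i lt_j e) => -> ->.
move=> [|i] [|j] u v lt_i lt_j /=.
- exact: copy_induced.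
- exact/negbTE/nadj.
- by rewrite adj_sym; apply/negbTE/nadj.
exact: giso.
Qed.

End Tight.
End Graph.
End Covers.

(** * Gluing two copies *)

Lemma giso_sym (F G : sgraph) : giso F G -> giso G F.
Proof.
case=> f [g fK gK] fadj; exists g; first by exists f.
by move=> x y; rewrite -fadj !gK.
Qed.

Lemma giso_card (F G : sgraph) : giso F G -> #|F| = #|G|.
Proof. by case=> f bij_f _; apply: bij_eq_card bij_f. Qed.

Lemma giso_arcs (F G : sgraph) : giso F G ->
  arcs (@adj F) setT setT = arcs (@adj G) setT setT.
Proof.
case=> f bij_f fadj; have <- : f @: setT = setT.
  by case: bij_f => g _ gK; apply/setP=> y; rewrite !inE -[y]gK imset_f.
by rewrite arcs_imset; [apply: eq_arcs | exact: bij_inj].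
Qed.

Lemma giso_covered (H F G : sgraph) : giso F G -> covered H F -> covered H G.
Proof.
case=> f [g fK gK] fadj covF y; have [h [inj_h emb_h] /codomP[x gy]] := covF (g y).
exists (f \o h).
  split; first exact: inj_comp (can_inj fK) inj_h.
  by move=> u v uv /=; rewrite fadj; apply: emb_h.
by apply/codomP; exists x; rewrite /= -gy gK.
Qed.

Lemma giso_regular (d : nat) (F G : sgraph) : giso F G -> regular d F -> regular d G.
Proof.
case=> f [g fK gK] fadj regF y; rewrite -(regF (g y)) -(card_imset _ (can_inj fK)).
apply: eq_card => z; rewrite -[z]gK (mem_imset _ _ (can_inj fK)) !inE -fadj !gK.
by [].
Qed.

(** Equivalent to [giso (induced S) H] by [spans_giso], but stated inside [G] so that counts of
    pairs need no subtype. *)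
Definition spans (H G : sgraph) (S : {set G}) : Prop :=
  exists2 f : H -> G, injective f /\ f @: setT = S & forall x y, adj (f x) (f y) = adj x y.

Lemma card_spans (H G : sgraph) (S : {set G}) : spans H S -> #|S| = #|H|.
Proof. by case=> f [inj_f <-] _; rewrite card_imset // cardsT. Qed.

Lemma arcs_spans (H G : sgraph) (S : {set G}) : spans H S ->
  arcs adj S S = arcs (@adj H) setT setT.
Proof. by case=> f [inj_f <-] fadj; rewrite arcs_imset //; apply: eq_arcs. Qed.

Lemma spans_giso (H G : sgraph) (S : {set G}) : spans H S <-> giso (induced S) H.
Proof.
split=> [spanS|/giso_sym[f [g fK gK] fadj]].
  have cardS := card_spans spanS; case: spanS => f [inj_f imf] fadj.
  have Sf x : f x \in S by rewrite -imf imset_f.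
  apply: giso_sym; exists (fun x => Sub (f x) (Sf x) : induced S) => [|x y]; last exact: fadj.
  apply: inj_card_bij; first by move=> x y /(congr1 val)/inj_f.
  by rewrite -cardS card_sig.
exists (val \o f) => //; split; first exact: inj_comp val_inj (can_inj fK).
apply/setP=> x; apply/imsetP/idP => [[y _ ->]|Sx]; first exact: valP.
by exists (g (Sub x Sx)); rewrite //= gK.
Qed.

Lemma contained_spans (H G : sgraph) (S V : {set G}) :
  spans H S -> V \subset S -> contained (induced V) H.
Proof.
case=> f [inj_f imf] fadj /subsetP sVS.
have imV (x : induced V) : val x \in codom f.
  by have := sVS _ (valP x); rewrite -imf => /imsetP[y _ ->]; apply: codom_f.
exists (fun x => iinv (imV x)); split=> [x y e|x y xy].
  by apply: val_inj; rewrite -(f_iinv (imV x)) e f_iinv.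
by rewrite -fadj !f_iinv.
Qed.

Lemma spans_induced (H G : sgraph) (X S : {set G}) : S \subset X -> spans H S ->
  @spans H (induced X) (val @^-1: S).
Proof.
move=> /subsetP sSX [f [inj_f imf] fadj].
have Xf x : f x \in X by apply: sSX; rewrite -imf imset_f.
exists (fun x => Sub (f x) (Xf x) : induced X) => [|x y]; last exact: fadj.
split=> [x y /(congr1 val)/inj_f //|]; apply/setP=> y; rewrite inE -imf.
by apply/imsetP/imsetP=> -[x _ e]; exists x => //; [rewrite e|apply: val_inj].
Qed.

Lemma imset_val_induced (G : sgraph) (X S : {set G}) : S \subset X ->
  val @: (val @^-1: S : {set induced X}) = S.
Proof.
move=> /subsetP sSX; apply/setP=> x; apply/imsetP/idP => [[y + ->]|Sx].
  by rewrite inE.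
by exists (Sub x (sSX _ Sx)); rewrite ?inE.
Qed.

Lemma card_preim_induced (G : sgraph) (X S : {set G}) : S \subset X ->
  #|(val @^-1: S : {set induced X})| = #|S|.
Proof. by move=> sSX; rewrite -{2}(imset_val_induced sSX) card_imset //; apply: val_inj. Qed.

Lemma arcs_preim_induced (G : sgraph) (X S : {set G}) : S \subset X ->
  arcs adj (val @^-1: S : {set induced X}) (val @^-1: S) = arcs adj S S.
Proof.
move=> sSX; rewrite -{3 4}(imset_val_induced sSX) arcs_imset //; exact: val_inj.
Qed.

Lemma arcs_induced (G : sgraph) (S : {set G}) :
  arcs (@adj (induced S)) setT setT = arcs adj S S.
Proof.
rewrite -(arcs_preim_induced (subxx S)); congr arcs; apply/setP=> x.
all: by rewrite !inE; apply/esym/valP.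
Qed.

Lemma contained_induced (G : sgraph) (S : {set G}) : contained (induced S) G.
Proof. by exists val; split=> //; apply: val_inj. Qed.

(** Passing to the subgraph induced on the image can only add edges, so [maxarcs], a maximum over
    vertex sets, also bounds subgraphs that are not induced. *)
Lemma contained_maxarcs (F H : sgraph) : contained F H ->
  arcs (@adj F) setT setT <= maxarcs H #|F|.
Proof.
case=> f [inj_f emb_f]; rewrite -cardsT -(card_imset _ inj_f).
by apply: leq_trans (leq_maxarcs _); rewrite arcs_imset //; apply: leq_arcs.
Qed.

Lemma densest_arcs (H G : sgraph) (m : nat) (V : {set G}) : m <= #|H| ->
  induces_densest_subgraph H m V -> arcs adj V V = maxarcs H m.
Proof.
move=> le_m [cardV subV maxV]; apply/eqP; rewrite eqn_leq; apply/andP; split.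
  by have := contained_maxarcs subV; rewrite arcs_induced card_sig cardV.
have [A cardA <-] := maxarcs_attained le_m.
rewrite -(arcs_induced A) -(arcs_induced V) -!nedges_arcs leq_pmul2l //.
by apply: maxV (contained_induced A); rewrite card_sig.
Qed.

Lemma arcs_densest (H G : sgraph) (m : nat) (V : {set G}) : #|V| = m ->
  contained (induced V) H -> arcs adj V V = maxarcs H m ->
  induces_densest_subgraph H m V.
Proof.
move=> cardV subV eqV; split=> // F cardF subF.
by rewrite -(leq_pmul2l (isT : 0 < 2)) !nedges_arcs arcs_induced eqV -cardF contained_maxarcs.
Qed.

Lemma in_L_induced (H G : sgraph) (r : nat) (A B : {set G}) :
    spans H A -> spans H B -> #|B :\: A| = r ->
    (forall x y, x \in A :\: B -> y \in B :\: A -> ~~ adj x y) ->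
    arcs adj (A :&: B) (A :&: B) = maxarcs H (#|H| - r) ->
  in_L H r (induced (A :|: B)).
Proof.
move=> spanA spanB cardBA noAB eqI.
have sA : A \subset A :|: B := subsetUl A B.
have sB : B \subset A :|: B := subsetUr A B.
have sI : A :&: B \subset A :|: B := subset_trans (subsetIl A B) sA.
have cardA := card_spans spanA; have cardB := card_spans spanB.
have cardI := cardsID A B; have cardI' := cardsID B A; rewrite setIC in cardI'.
have preA : val @^-1: (A :\: B) :|: val @^-1: (A :&: B)
            = (val @^-1: A : {set induced (A :|: B)}).
  by apply/setP=> x; rewrite !inE; case: (val x \in A); case: (val x \in B).
have preB : val @^-1: (B :\: A) :|: val @^-1: (A :&: B)
            = (val @^-1: B : {set induced (A :|: B)}).
  by apply/setP=> x; rewrite !inE; case: (val x \in A); case: (val x \in B).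
exists (val @^-1: (A :&: B)), (val @^-1: (A :\: B)), (val @^-1: (B :\: A)); split.
- split; last 3 first.
  1-3: by rewrite -setI_eq0; apply/eqP/setP=> x; rewrite !inE;
          case: (val x \in A); case: (val x \in B).
  apply/setP=> x; have := valP x; rewrite !inE.
  by case: (val x \in A); case: (val x \in B).
- rewrite !card_preim_induced ?(subset_trans (subsetDl _ _)) //.
  by split; lia.
- by move=> x y; rewrite !inE => xA yB; apply: noAB; rewrite inE.
- apply: arcs_densest.
  + by rewrite card_preim_induced //; rewrite setIC; lia.
  + apply: contained_spans (spans_induced sA spanA) _.
    by apply/subsetP=> x; rewrite !inE => /andP[].
  by rewrite arcs_preim_induced.
by rewrite preA preB; split; apply/spans_giso/spans_induced.
Qed.

Lemma arcs_dunion (F G : sgraph) : arcs (@adj (dunion F G)) setT setT =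
  arcs (@adj F) setT setT + arcs (@adj G) setT setT.
Proof.
have -> : [set: dunion F G] = inl @: [set: F] :|: inr @: [set: G].
  by apply/setP=> -[x|x]; rewrite !inE imset_f ?orbT.
rewrite arcsUU; last first.
- by rewrite -setI_eq0; apply/eqP/setP=> x; rewrite !inE; apply/andP=> -[/imsetP[y _ ->] /imsetP[]].
- exact: adj_sym.
rewrite !arcs_imset; try by move=> ? ? [].
rewrite (@arcs_eq0 _ _ (inr @: _)); last by move=> _ _ /imsetP[x _ ->] /imsetP[y _ ->].
by rewrite muln0 addn0.
Qed.

Lemma regular_copies (d k : nat) (H : sgraph) : regular d H -> regular d (copies k H).
Proof.
move=> regH [i x]; pose pr (y : H) : copies k H := (i, y).
rewrite -(regH x) -(card_imset (f := pr)); last by move=> ? ? [].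
congr #|pred_of_set _|; apply/setP=> -[j y]; rewrite !inE /= /copies_adj /=.
apply/andP/imsetP => [[/eqP<- xy]|[z + [-> ->]]]; first by exists y; rewrite ?inE.
by rewrite inE eqxx.
Qed.

Lemma covered_dunion_copies (H L : sgraph) (k : nat) :
  covered H L -> covered H (dunion L (copies k H)).
Proof.
move=> covL [x|[i x]].
  have [f [inj_f emb_f] /codomP[y ->]] := covL x.
  exists (inl \o f); last exact: (codom_f (inl \o f)).
  by split=> // u v /= [/inj_f].
exists (fun y => inr (i, y)); last exact: (codom_f (fun y => inr (i, y))).
by split=> [u v []//|u v uv] /=; rewrite /copies_adj eqxx.
Qed.

Lemma in_L_card (H L : sgraph) (r : nat) : in_L H r L -> r <= #|H| -> #|L| = #|H| + r.
Proof.
case=> [V [V1 [V2 [[eT dV1 dV2 d12] [cV1 cV2] _ [cV _ _] _]]]] le_r.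
rewrite -cardsT -eT !cardsU setIUl !(disjoint_setI0 _) // setU0 cards0; lia.
Qed.

Lemma in_L_covered (H L : sgraph) (r : nat) : in_L H r L -> covered H L.
Proof.
case=> [V [V1 [V2 [[eT _ _ _] _ _ _ [/spans_giso span1 /spans_giso span2]]]]] x.
have cov (S : {set L}) : spans H S -> x \in S ->
    exists2 f : H -> L, embedding f & x \in codom f.
  case=> f [inj_f <-] fadj /imsetP[y _ ->]; exists f; last exact: codom_f.
  by split=> // u v; rewrite fadj.
have : x \in V :|: V1 :|: V2 by rewrite eT.
by rewrite !inE -orbA => /or3P[] Vx; [apply: cov span1 _|apply: cov span1 _|apply: cov span2 _];
  rewrite !inE Vx ?orbT.
Qed.

(** * Edge-minimal graphs in the dense case *)

Section Ideal.
Variables (H : sgraph) (d : nat).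
Hypothesis regH : regular d H.
Hypothesis dense : #|H| <= 2 * d + 1.

(** By inclusion-exclusion the count is twice that of [H] minus that of [V], that is
    [2 * (#|H| * d) - maxarcs H (#|H| - r)]; [maxarcs_compl] turns this into [minarcs]. *)
Lemma in_L_arcs (L : sgraph) (r : nat) : in_L H r L -> r < #|H| ->
  arcs (@adj L) setT setT = minarcs H d (#|H| + r).
Proof.
case=> [V [V1 [V2 [[eT dV1 dV2 d12] [cV1 cV2] no12 denV [/spans_giso span1 /spans_giso span2]]]]].
move=> lt_r; have := densest_arcs (leq_subr r #|H|) denV.
have := arcs_spans span1; have := arcs_spans span2.
rewrite !(arcsT _ regH) cardsT -eT.
have d12' : [disjoint V :|: V1 & V2] by rewrite -setI_eq0 setIUl !(disjoint_setI0 _) // setU0.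
have sym := @adj_sym L.
rewrite (arcsUU sym d12') (arcsUr adj V2 dV1) (setUC V2) (setUC V1).
rewrite (arcsUU sym dV2) (arcsC V2 V1 sym) (arcs_eq0 no12).
have := maxarcs_compl regH (ltnW lt_r); have := cutminE regH r.
rewrite /minarcs modnDl modn_small // mulnDl; lia.
Qed.

(* Two copies of H glued along the complement of a densest r-subset S; the
   boolean component tells apart the two copies of S. *)
Lemma exists_in_L (r : nat) : r < #|H| -> exists L, in_L H r L.
Proof.
move=> lt_r; have [S cardS eqS] := maxarcs_attained (ltnW lt_r).
pose e (u v : H * bool) := adj u.1 v.1 && [|| u.2 == v.2, u.1 \notin S | v.1 \notin S].
have sym_e : symmetric e by move=> u v; rewrite /e adj_sym eq_sym; congr (_ && (_ || _)); rewrite orbC.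
have irr_e : irreflexive e by move=> u; rewrite /e adj_irrefl.
pose D := SGraph sym_e irr_e.
pose f (b : bool) (x : H) : D := (x, b && (x \in S)).
have inj_f b : injective (f b) by move=> x y [].
have spanf b : spans H (f b @: setT).
  exists (f b) => // x y; rewrite /= /e /=.
  by case: (x \in S); case: (y \in S); rewrite ?eqxx ?orbT ?andbT.
have imf b x c : ((x, c) \in f b @: setT) = (c == b && (x \in S)).
  by apply/imsetP/eqP => [[y _ [-> ->]] //|->]; exists x.
(* The pairs [(x, true)] with [x] outside [S] lie in neither image and are discarded here. *)
exists (induced (f false @: setT :|: f true @: setT)); apply: in_L_induced => //.
- rewrite -cardS -(card_imset _ (inj_f true)); apply: eq_card => -[x c].
  rewrite inE !imf /=; apply/idP/imsetP => [/andP[]|[y Sy [-> ->]]]; last by rewrite Sy.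
  by case: c => // _ /eqP/esym Sx; exists x; rewrite // /f Sx.
- move=> [x c] [y b]; rewrite !inE !imf /= /e /=.
  by case: (x \in S); case: (y \in S); case: c; case: b; rewrite ?andbF.
have -> : f false @: setT :&: f true @: setT = f false @: (~: S).
  apply/setP=> -[x c]; rewrite inE !imf /=; apply/idP/imsetP => [|[y + [-> ->]]].
    case/andP=> /eqP-> /eqP/esym/negbT xS; exists x; by rewrite ?inE.
  by rewrite inE => /negPf->.
rewrite arcs_imset //; have -> : arcs (fun x y => adj (f false x) (f false y)) (~: S) (~: S)
    = arcs adj (~: S) (~: S).
  by apply: eq_arcs => x y; rewrite /= /e /= andbT.
(* The complement of a densest [r]-set is densest for its own size. *)
have := arcs_setCC regH S; have := maxarcs_compl regH (ltnW lt_r).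
by rewrite cardS eqS; lia.
Qed.

Lemma in_L_edge_minimal (q r : nat) (L G : sgraph) : r < #|H| -> 0 < q ->
  in_L H r L -> giso G (dunion L (copies (q - 1) H)) ->
  [/\ #|G| = q * #|H| + r, covered H G &
      arcs (@adj G) setT setT = minarcs H d (q * #|H| + r)].
Proof.
case: q => // q lt_r _ inL isoG; rewrite subn1 /= in isoG.
have cardL := in_L_card inL (ltnW lt_r); split.
- by rewrite (giso_card isoG) card_sum cardL card_prod card_ord; lia.
- by apply: giso_covered (giso_sym isoG) _; apply/covered_dunion_copies/in_L_covered/inL.
rewrite (giso_arcs isoG) arcs_dunion (in_L_arcs inL lt_r).
rewrite (arcsT _ (@regular_copies d q H regH)) cardsT card_prod card_ord.
by rewrite /minarcs modnDl modnMDl; lia.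
Qed.

(** The lower bound [minarcs_le] is attained by a graph from [exists_in_L] together with disjoint
    copies of [H], so being minimal means meeting the bound. *)
Lemma edge_minimal_arcs (q r : nat) (G : sgraph) : r < #|H| -> 0 < q ->
  edge_minimal H (q * #|H| + r) G <->
  [/\ #|G| = q * #|H| + r, covered H G &
      arcs (@adj G) setT setT = minarcs H d (q * #|H| + r)].
Proof.
move=> lt_r q_gt0; have H_gt0 := leq_ltn_trans (leq0n r) lt_r.
split=> -[cardG covG minG]; split=> //.
  apply/eqP; rewrite eqn_leq andbC -{1}cardG (minarcs_le regH) //=.
  have [L inL] := exists_in_L lt_r.
  have isoL : giso (dunion L (copies (q - 1) H)) (dunion L (copies (q - 1) H)).
    by exists id => //; exists id.
  have [cardL covL <-] := in_L_edge_minimal lt_r q_gt0 inL isoL.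
  by rewrite -!nedges_arcs leq_pmul2l //; apply: minG.
move=> G' cardG' covG'; rewrite -(leq_pmul2l (isT : 0 < 2)) !nedges_arcs minG -cardG'.
exact: minarcs_le.
Qed.

Lemma arcs_in_span (G : sgraph) (B S : {set G}) : spans H B -> S \subset B ->
  arcs adj S S + arcs adj S (B :\: S) = #|S| * d /\ arcs adj S S <= maxarcs H #|S|.
Proof.
case=> f [inj_f imf] fadj sSB; pose S0 := f @^-1: S.
have defS : S = f @: S0.
  apply/setP=> y; apply/idP/imsetP => [Sy|[x + ->]]; last by rewrite inE.
  by have := subsetP sSB _ Sy; rewrite -imf => /imsetP[x _ e]; exists x; rewrite // inE -e.
have defD : B :\: S = f @: (~: S0).
  apply/setP=> y; rewrite inE -imf; apply/andP/imsetP => [[yS /imsetP[x _ e]]|[x + ->]].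
    by exists x; rewrite // !inE -e.
  by rewrite !inE imset_f.
have cardS : #|S| = #|S0| by rewrite defS card_imset.
have arcsf (C E : {set H}) : arcs adj (f @: C) (f @: E) = arcs adj C E.
  by rewrite arcs_imset //; apply: eq_arcs.
by rewrite defD cardS defS !arcsf (arcs_setC regH) leq_maxarcs.
Qed.

Lemma decompose_minimal (q r : nat) (G : sgraph) : r < #|H| -> 0 < q ->
  #|G| = q * #|H| + r -> covered H G ->
  arcs (@adj G) setT setT = minarcs H d (q * #|H| + r) ->
  exists2 L : sgraph, in_L H r L & giso G (dunion L (copies (q - 1) H)).
Proof.
move=> lt_r q_gt0 cardG covG; rewrite -cardG => minG.
have H_gt0 := leq_ltn_trans (leq0n r) lt_r.
have le_HG : #|H| <= #|G| by rewrite cardG; apply: leq_trans (leq_pmull _ q_gt0) (leq_addr _ _).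
have [A [B [copyA copyB]]] := exists_overlap regH dense H_gt0 covG minG le_HG.
rewrite cardG modnMDl modn_small // => cardBA.
have spanC (C : {set G}) : copy_of H C -> spans H C.
  case=> f emb_f ->; exists f; first by case: emb_f.
  by move=> x y; rewrite (copy_induced regH dense H_gt0 covG minG x y emb_f).
have tA := tight_copy regH dense H_gt0 covG minG copyA.
have tAB := tight_add_copy regH dense H_gt0 covG minG copyB tA.
have cardAB := card_setU_diff A B; rewrite cardBA (card_copy copyA) in cardAB.
have sym := @adj_sym G.
(* Adding [B :\: A] to the tight set [A] brings exactly [2 * r * d - maxarcs H r] pairs, and the
   edges of [B] alone account for [2 * r * d] minus the pairs inside [B :\: A]. Hence nothing joins
   [B :\: A] to [A :\: B], and [B :\: A] is densest for its size, so its complement [A :&: B] in [B]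
   is too. *)
have arcsAB : arcs adj (B :\: A) (A :\: B) = 0 /\
    arcs adj (A :&: B) (A :&: B) = maxarcs H (#|H| - r).
  have [eS leS] := arcs_in_span (spanC B copyB) (subsetDl B A).
  have eB := arcs_spans (spanC B copyB); rewrite (arcsT _ regH) cardsT in eB.
  have eAB := tAB; rewrite /tight cardAB setU_diff arcsUU ?disjoint_diff // tA in eAB.
  rewrite /minarcs (card_copy copyA) modnDl modnn modn_small // cutmin0 in eAB.
  have dA : [disjoint A :&: B & A :\: B].
    by rewrite -setI_eq0; apply/eqP/setP=> x; rewrite !inE; case: (x \in B); rewrite ?andbF.
  have dB : [disjoint A :&: B & B :\: A].
    by rewrite -setI_eq0; apply/eqP/setP=> x; rewrite !inE; case: (x \in A); rewrite ?andbF.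
  have := arcsUr adj (B :\: A) dA; rewrite setID => eSA.
  have eBB := arcsUU sym dB; rewrite [X in arcs _ (X :|: _)]setIC in eBB.
  rewrite [X in arcs _ _ (X :|: _)]setIC setID eB in eBB.
  rewrite setDDr setDv set0U setIC in eS.
  rewrite cardBA in eS leS.
  have := maxarcs_compl regH (ltnW lt_r); have := cutminE regH r; lia.
case: arcsAB => noAB eqI.
have inL : in_L H r (induced (A :|: B)).
  apply: in_L_induced => //; [exact: spanC|exact: spanC|move=> x y xA yB].
  apply/negP; rewrite adj_sym => yx.
  by have := @arcs_gt0 _ adj _ _ _ _ yB xA yx; rewrite noAB.
exists (induced (A :|: B)) => //; apply: giso_sym.
have [f0 _ _] := copyA.
have cardq : #|A :|: B| + (q - 1) * #|H| = #|G| by rewrite cardAB cardG mulnBl; nia.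
have [g [gX gadj ginj gg]] := split_disjoint_copies regH dense H_gt0 covG minG f0 tAB cardq.
pose p (u : dunion (induced (A :|: B)) (copies (q - 1) H)) : G :=
  match u with inl x => val x | inr v => g v.1 v.2 end.
exists p.
  apply: inj_card_bij; last first.
    by rewrite card_sum card_sig card_prod card_ord -cardq.
  move=> [x|[i u]] [y|[j v]] /= e.
  - by rewrite (val_inj e).
  - by have := gX j v (ltn_ord j); rewrite -e (valP x).
  - by have := gX i u (ltn_ord i); rewrite e (valP y).
  by case: (ginj i j u v (ltn_ord i) (ltn_ord j) e) => /ord_inj-> ->.
move=> [x|[i u]] [y|[j v]] //=.
- exact/negbTE/gadj/(valP x)/ltn_ord.
- by rewrite adj_sym; apply/negbTE/gadj/(valP y)/ltn_ord.
by rewrite gg.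
Qed.

Lemma dense_regular_ideal : ideal H.
Proof.
move=> r lt_r q q_gt0 G; split.
  case/(edge_minimal_arcs _ lt_r q_gt0) => cardG covG.
  exact: decompose_minimal lt_r q_gt0 cardG covG.
case=> L inL isoG; apply/(edge_minimal_arcs _ lt_r q_gt0).
exact: in_L_edge_minimal lt_r q_gt0 inL isoG.
Qed.

End Ideal.

(** * Non-ideal regular graphs *)

(** The circulant graph on the integers modulo [m] with jumps 1, ..., [h] and their opposites;
    [2 * h < m] makes these [2 * h] jumps distinct and non-zero. *)
Lemma exists_regular (m h : nat) : 2 * h < m ->
  exists2 G : sgraph, #|G| = m & regular (2 * h) G.
Proof.
case: m => // m lt_hm.
(* Ordinals start at 0, so the index [j] stands for the jump [j.+1]. *)
pose s (j : 'I_h) : 'I_m.+1 := inord j.+1.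
have valS j : s j = j.+1 :> nat by rewrite inordK //; have := ltn_ord j; lia.
pose D := s @: setT :|: (fun j => - s j)%R @: setT.
have valN j : (- s j)%R = m - j :> nat.
  by rewrite /= valS modn_small; have := ltn_ord j; lia.
have oppD x : x \in D -> (- x)%R \in D.
  rewrite !inE => /orP[]/imsetP[j _ ->]; first by rewrite (imset_f (fun j => - s j)%R) ?orbT.
  by rewrite /= GRing.opprK imset_f.
have symD x : (x \in D) = ((- x)%R \in D).
  by apply/idP/idP => /oppD //; rewrite GRing.opprK.
have sym_e : symmetric (fun x y : 'I_m.+1 => (y - x)%R \in D).
  by move=> x y; rewrite symD GRing.opprB.
have irr_e : irreflexive (fun x y : 'I_m.+1 => (y - x)%R \in D).
  move=> x; rewrite GRing.subrr; apply/negP; rewrite inE => /orP[]/imsetP[j _ /(congr1 val)].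
    by rewrite /= valS.
  by rewrite [RHS]valN /=; have := ltn_ord j; lia.
exists (SGraph sym_e irr_e) => [|x]; first exact: card_ord.
have -> : [set y | adj x y] = (fun z : 'I_m.+1 => z + x)%R @: D :> {set 'I_m.+1}.
  apply/setP=> y; rewrite inE; apply/idP/imsetP => [Dyx|[z Dz ->]].
    by exists (y - x)%R; rewrite ?GRing.subrK.
  by rewrite /= GRing.addrK.
rewrite card_imset; last exact: GRing.addIr.
have inj_s : injective s by move=> i j /(congr1 val); rewrite /= !valS => -[/ord_inj].
rewrite cardsU disjoint_setI0.
  rewrite cards0 !card_imset ?cardsT ?card_ord //; first by lia.
  by move=> i j /GRing.oppr_inj/inj_s.
rewrite -setI_eq0; apply/eqP/setP=> x'; rewrite !inE; apply/andP=> -[/imsetP[i _ ->]].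
case/imsetP=> j _ /(congr1 val) /=; rewrite [RHS]valN valS.
by have := ltn_ord i; have := ltn_ord j; lia.
Qed.

Lemma regular_dunion (d : nat) (F G : sgraph) :
  regular d (dunion F G) <-> regular d F /\ regular d G.
Proof.
have degl x : #|[set y : dunion F G | adj (inl x : dunion F G) y]| = #|[set y : F | adj x y]|.
  pose l (y : F) : dunion F G := inl y.
  rewrite -(card_imset (f := l)); last by move=> ? ? [].
  congr #|pred_of_set _|; apply/setP=> -[y|y]; rewrite !inE /=.
    by apply/idP/imsetP => [xy|[z + [->]]]; [exists y; rewrite ?inE|rewrite inE].
  by apply/esym/imsetP => -[].
have degr x : #|[set y : dunion F G | adj (inr x : dunion F G) y]| = #|[set y : G | adj x y]|.
  pose l (y : G) : dunion F G := inr y.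
  rewrite -(card_imset (f := l)); last by move=> ? ? [].
  congr #|pred_of_set _|; apply/setP=> -[y|y]; rewrite !inE /=.
    by apply/esym/imsetP => -[].
  by apply/idP/imsetP => [xy|[z + [->]]]; [exists y; rewrite ?inE|rewrite inE].
split=> [reg|[regF regG] [x|x]].
- by split=> x; [rewrite -degl|rewrite -degr]; apply: reg.
- exact: etrans (degl x) (regF x).
exact: etrans (degr x) (regG x).
Qed.

(** Every vertex keeps the [d] neighbours that it has in a copy through it. *)
Lemma covered_arcs (H G : sgraph) (d : nat) : regular d H -> covered H G ->
  #|G| * d <= arcs (@adj G) setT setT.
Proof.
move=> regH covG; rewrite arcs_degree -cardsT -sum_nat_const; apply: leq_sum => x _.
have [f [inj_f emb_f] /codomP[y ->]] := covG x; rewrite -(regH y) -(card_imset _ inj_f).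
apply/subset_leq_card/subsetP=> _ /imsetP[z + ->]; rewrite !inE; exact: emb_f.
Qed.

Lemma regular_covered_minimal (H G : sgraph) (d : nat) : regular d H -> regular d G ->
  covered H G -> edge_minimal H #|G| G.
Proof.
move=> regH regG covG; split=> // G' cardG' covG'.
rewrite -(leq_pmul2l (isT : 0 < 2)) !nedges_arcs (arcsT _ regG) cardsT -cardG'.
exact: covered_arcs covG'.
Qed.

(** The [d] neighbours of [x] inside [S] already exhaust its degree in [L]. *)
Lemma nbhd_in_span (H L : sgraph) (d : nat) (S : {set L}) (x : L) :
  regular d H -> regular d L -> spans H S -> x \in S -> [set y | adj x y] \subset S.
Proof.
move=> regH regL [f [inj_f <-] fadj] /imsetP[u _ ->].
have -> : [set y | adj (f u) y] = f @: [set v | adj u v].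
  apply/esym/eqP; rewrite eqEcard card_imset // regH regL leqnn andbT.
  by apply/subsetP=> _ /imsetP[v + ->]; rewrite !inE fadj.
exact/imsetS/subsetT.
Qed.

(* In a d-regular member of L, the common part V of the two copies of H would
   be a union of connected components. *)
Lemma in_L_regular_card (H L : sgraph) (d r : nat) : regular d H -> regular d L ->
  r < #|H| -> in_L H r L -> d < #|H| - r.
Proof.
move=> regH regL lt_r [V [V1 [V2 [[_ _ _ d12] _ _ [cardV _ _] [/spans_giso s1 /spans_giso s2]]]]].
have /card_gt0P[x Vx] : 0 < #|V| by rewrite cardV subn_gt0.
rewrite -cardV -(regL x); apply/proper_card/properP; split; last first.
  by exists x; rewrite // inE adj_irrefl.
have n1 := nbhd_in_span regH regL s1 _; have n2 := nbhd_in_span regH regL s2 _.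
apply/subsetP=> y xy; have := subsetP (n1 x _) y xy; have := subsetP (n2 x _) y xy.
rewrite !inE Vx !orbT => /(_ isT) + /(_ isT).
by case: (y \in V) => //; rewrite !orbF => V2y /(disjointFr d12); rewrite V2y.
Qed.

Lemma dunion_not_ideal (d : nat) (F G : sgraph) : regular d F -> regular d G ->
  #|F| < #|G| <= #|F| + d -> ~ ideal (dunion F G).
Proof.
move=> regF regG /andP[ltFG leGF] idealH; set H := dunion F G in idealH.
have cardH : #|H| = #|F| + #|G| := card_sum _ _.
have regH : regular d H by apply/regular_dunion.
pose K := dunion (copies 3 F) G.
have regK : regular d K by apply/regular_dunion; split; [apply: regular_copies|].
have cardK : #|K| = 1 * #|H| + 2 * #|F| by rewrite card_sum card_prod card_ord cardH; lia.
have covK : covered H K.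
  pose h i (u : H) : K := match u with inl x => inl (i, x) | inr y => inr y end.
  have emb i : embedding (h i).
    by split=> [[x|x] [y|y] // [->]|[x|x] [y|y] //=]; rewrite /copies_adj /= ?eqxx.
  move=> [[i x]|y].
    by exists (h i) => //; apply/codomP; exists (inl x).
  by exists (h ord0) => //; apply/codomP; exists (inr y).
(* This is where [#|F| < #|G|] enters. The other bound, [#|G| <= #|F| + d], says [#|H| - r <= d] for
   [r = 2 * #|F|] and contradicts [in_L_regular_card] at the end. *)
have lt_r : 2 * #|F| < #|H| by lia.
have := regular_covered_minimal regH regK covK; rewrite cardK.
case/(idealH _ lt_r 1 isT) => L inL isoK.
have [regL _] := (regular_dunion _ _ _).1 (giso_regular isoK regK).
by have := in_L_regular_card regH regL lt_r inL; lia.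
Qed.

Theorem theorem1p2 :
  (forall (n d : nat) (H : sgraph),
     #|H| = n -> regular d H -> n - 1 <= 2 * d -> ideal H)
  /\
  (forall n d : nat,
     largest_even_below_half n d -> 0 < d -> n <> 2 * d + 2 ->
     exists H : sgraph, [/\ #|H| = n, regular d H & ~ ideal H]).
Proof.
split=> [n d H <- regH le_nd|n d [even_d lt_dn max_d] d_gt0 ne_n].
  by apply: dense_regular_ideal regH _; lia.
have d2 : 2 * d./2 = d by rewrite mul2n even_halfK.
have le_n : n - 1 <= 2 * (d + 2).
  by rewrite leqNgt; apply/negP=> /max_d; rewrite oddD (negPf even_d) => /(_ isT); lia.
(* Since [d + 2] is the next even number, [n] is one of [2 * d + 3], [2 * d + 4], [2 * d + 5]. The
   nearly equal parts then exceed [d] and differ by 1 or 2, which is at most [d] because [d] is even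
   and positive. *)
have [a [b [eab lt_da lt_ab le_ab]]] :
    exists a b, [/\ a + b = n, d < a, a < b & b <= a + d].
  by exists (n - 1)./2, (n - (n - 1)./2); split; lia.
have [F cardF] := @exists_regular a d./2 ltac:(lia).
have [G cardG] := @exists_regular b d./2 ltac:(lia).
rewrite d2 => regG regF; exists (dunion F G); split.
- by rewrite card_sum cardF cardG.
- exact/regular_dunion.
by apply: (dunion_not_ideal regF regG); rewrite cardF cardG lt_ab.
Qed.
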